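(* Let $(a_{ij})_{1\le i,j\le n}$ be i.i.d. nonnegative random variables (costs) whose common distribution, not depending on $n$, has a density in the class $\mathcal{P}^+(1)$. Let $S_n$ be the group of all permutations of $\{1,\ldots,n\}$ and let $$C_n:=\min_{\pi\in S_n}\sum_{i=1}^n a_{i\pi(i)}$$ be the optimal cost in the random assignment problem. Then $C_n$ has fluctuations of order at least $n^{-1/2}$.
   Context: Class $\mathcal{P}^+(1)$: the set of all probability densities of the form $e^{-V}$ on $[0,\infty)$, such that $V$ is a $C^\infty$ function in $(0,\infty)$, $V$ and all its derivatives have at most polynomial growth at infinity and extend continuously to $0$, and $e^{V}$ increases faster than any polynomial at infinity. Fluctuations: for a sequence of random variables $\{X_n\}$ and a sequence of positive real numbers $\{\delta_n\}$, we say that $X_n$ has fluctuations of order at least $\delta_n$ if there are positive constants $c_1,c_2$ such that for all large $n$, and for all $-\infty<a\le b<\infty$ with $b-a\le c_1\delta_n$, $\mathbb{P}(a\le X_n\le b)\le 1-c_2$. *)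

(* Defs.v *)
From HB Require Import structures.
From mathcomp Require Export all_boot all_order all_fingroup all_algebra.
From mathcomp Require Export all_classical all_reals all_analysis measurable_realfun.
Export Order.TTheory GRing.Theory Num.Theory.
Export numFieldNormedType.Exports.

Set Implicit Arguments.
Unset Strict Implicit.
Unset Printing Implicit Defensive.

Local Open Scope classical_set_scope.
Local Open Scope ring_scope.

(* A density on [0, +oo[ is encoded as a function on R vanishing on ]-oo, 0[.
   Only the values of V on [0, +oo[ matter: all the conditions below are local
   to ]0, +oo[, to the right neighbourhoods of 0, or to +oo. *)
Definition class_Pplus1 (R : realType) (f : R -> R) : Prop :=
  exists V : R -> R,
    [/\ (forall x, f x = if 0 <= x then expR (- V x) else 0) /\
        (\int[lebesgue_measure]_x (f x)%:E = 1)%E,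
        forall (k : nat) (x : R), 0 < x -> derivable (derive1n k V) x 1,
        forall k : nat, exists p : {poly R},
          \forall x \near +oo, `|derive1n k V x| <= p.[x],
        (V x @[x --> 0^'+] --> V 0) /\
        (forall k : nat, exists l : R, derive1n k V x @[x --> 0^'+] --> l)
      & forall p : {poly R}, (p.[x] / expR (V x)) @[x --> +oo] --> (0 : R)].

Definition has_density (R : realType) (mu : set R -> \bar R) (f : R -> R) :
    Prop :=
  forall A : set R, measurable A ->
    mu A = (\int[lebesgue_measure]_(x in A) (f x)%:E)%E.

Definition mutually_independent (R : realType) (d : measure_display)
    (T : measurableType d) (P : probability T R) (I : finType)
    (X : I -> {RV P >-> R}) : Prop :=
  forall (J : {set I}) (B : I -> set R), (forall i, measurable (B i)) ->
    (P (\bigcap_(i in [set` J]) X i @^-1` B i) =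
     \prod_(i in J) P (X i @^-1` B i))%E.

Arguments mutually_independent {R d T} P {I} X.

(* The random variables may live on different probability spaces. *)
Definition fluctuations_at_least (R : realType) (d : nat -> measure_display)
    (T : forall n, measurableType (d n)) (P : forall n, probability (T n) R)
    (X : forall n, {RV (P n) >-> R}) (delta : nat -> R) : Prop :=
  exists c1 c2 : R, [/\ 0 < c1, 0 < c2 &
    \forall n \near \oo, forall a b : R, a <= b -> b - a <= c1 * delta n ->
      (P n [set w | (a <= X n w <= b)%R] <= (1 - c2)%:E)%E].

Arguments fluctuations_at_least {R d T} P X delta.

Section optimal_cost.
Context (R : realType) (d : measure_display) (T : measurableType d)
  (P : probability T R) (n : nat) (a : 'I_n -> 'I_n -> {RV P >-> R}).

(* The default value of the iterated minimum is the cost of the identity, one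
   of the values minimised over. *)
Definition optimal_cost (w : T) : R :=
  \big[Num.min/(\sum_(i < n) a i i w)]_(s : 'S_n)
    (\sum_(i < n) a i (s i) w).

Lemma measurable_optimal_cost : measurable_fun [set: T] optimal_cost.
Proof.
have mS (p : 'I_n -> 'I_n) :
    measurable_fun [set: T] (fun w => \sum_(i < n) a i (p i) w).
  by apply: measurable_sum => i; exact: measurable_funPT.
suff mr (r : seq 'S_n) : measurable_fun [set: T]
    (fun w => \big[Num.min/(\sum_(i < n) a i i w)]_(s <- r)
                (\sum_(i < n) a i (s i) w)) by exact: mr.
elim: r => [|s r ih].
  by apply: (eq_measurable_fun _ _ (mS id)) => w _; rewrite big_nil.
apply: (eq_measurable_fun _ _ (measurable_minr (mS s) ih)) => w _.
by rewrite big_cons.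
Qed.

HB.instance Definition _ :=
  isMeasurableFun.Build _ _ _ _ optimal_cost measurable_optimal_cost.

End optimal_cost.

Arguments optimal_cost {R d T} P {n} a w.

(* Main.v *)
Require Import Defs.
From mathcomp Require Import zify ring lra.

(** What drives the proof is an upper bound [M] for the density.

    Cut the line into [N = 100 n^2] cells of equal probability [1/N].  The cell
    indices of the [n^2] costs then form a uniform configuration [k].  Add
    independent marks, each present with probability [1/r], where [r] is of
    order [sqrt n], and define a second configuration [k'] by lowering every
    index by one and every marked index by [n] more ([lower]).  Two facts are
    in conflict with a cost that is concentrated on an interval much shorter than
    [n^(-1/2)].

    On the one hand, [k'] is almost as random as [k].  The density of its law
    with respect to the uniform law has second moment [1 + O(1/n^2)] in each
    coordinate ([sum_sqr_lower_fiber]), hence a bounded second moment for the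
    [n^2] coordinates together, and by Cauchy-Schwarz ([sqr_card_push_le]) what
    is likely for [k] stays reasonably likely for [k'].

    On the other hand, [k'] is cheaper.  A permutation that is optimal for [k]
    is chosen without looking at the marks, so about [n/r], that is of order
    [sqrt n], of its [n] entries are marked ([card_few_moved_le]).  Each of
    these falls by [n] cells, hence by at least [n / (N M) = 1 / (100 n M)],
    because an interval of length [h] has probability at most [M h]
    ([exists_quantile_chain]).  The other entries do not increase: lowering by
    one puts the whole new cell below the old one, which absorbs the error made
    by replacing costs by cells.  The optimal cost therefore drops by an amount
    of order [sqrt n / n = n^(-1/2)].

    If the cost lay in so short an interval with probability above 7/8, both
    configurations could be realised in that interval
    ([exists_lowered_pair]), contradicting the drop
    ([optimal_cost_interval_le]). *)

Set Implicit Arguments.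
Unset Strict Implicit.
Unset Printing Implicit Defensive.

Local Open Scope ring_scope.

(** * Counting in finite product spaces *)

(** Cauchy-Schwarz against the constant 1, for natural numbers. *)
Lemma sqr_sum_le (I : finType) (D : {set I}) (g : I -> nat) :
  ((\sum_(i in D) g i) ^ 2 <= #|D| * \sum_(i in D) g i ^ 2)%N.
Proof.
have h i j : (2 * (g i * g j) <= g i ^ 2 + g j ^ 2)%N by exact: nat_Cauchy.
suff: (2 * (\sum_(i in D) g i) ^ 2 <= 2 * (#|D| * \sum_(i in D) g i ^ 2))%N.
  by rewrite leq_pmul2l.
have -> : (2 * (\sum_(i in D) g i) ^ 2 =
    \sum_(i in D) \sum_(j in D) 2 * (g i * g j))%N.
  rewrite expnS expn1 big_distrlr /= big_distrr /=.
  by apply: eq_bigr => i _; rewrite big_distrr.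
have -> : (2 * (#|D| * \sum_(i in D) g i ^ 2) =
    \sum_(i in D) \sum_(j in D) (g i ^ 2 + g j ^ 2))%N.
  transitivity (\sum_(i in D) (#|D| * g i ^ 2 + \sum_(j in D) g j ^ 2))%N.
    by rewrite big_split /= sum_nat_const -big_distrr /= mul2n addnn.
  by apply: eq_bigr => i _; rewrite big_split /= sum_nat_const.
by apply: leq_sum => i _; apply: leq_sum => j _; exact: h.
Qed.

Lemma card_sum (T : finType) (P : pred T) :
  #|[set x | P x]| = (\sum_x P x)%N.
Proof.
rewrite -sum1_card big_mkcond /=; apply: eq_bigr => x _; rewrite inE.
by case: (P x).
Qed.

(** The second-moment bound for densities, in counting form.  Dividing by the
    square of the number of pairs, the left-hand side is the squared
    probability that the image under [phi], coordinate by coordinate, of a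
    uniform point of the product space falls in [D]; Cauchy-Schwarz bounds it
    by the uniform probability of [D] times the second moment of the density of
    the image law, and this moment is the [#|E|]-th power of its value for one
    coordinate because the coordinates are independent. *)
Lemma sqr_card_push_le (E S B : finType) (phi : S -> B -> S)
    (D : {set {ffun E -> S}}) :
  (#|[set w : {ffun E -> S} * {ffun E -> B} |
       [ffun e => phi (w.1 e) (w.2 e)] \in D]| ^ 2 <=
   #|D| * (\sum_s (\sum_x \sum_y (phi x y == s)) ^ 2) ^ #|E|)%N.
Proof.
(* Given the image [k] of the pair, its coordinates have independent fibres. *)
pose c s := (\sum_x \sum_y (phi x y == s))%N.
have -> : #|[set w : {ffun E -> S} * {ffun E -> B} |
    [ffun e => phi (w.1 e) (w.2 e)] \in D]| =
    (\sum_(k in D) \prod_e c (k e))%N.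
  rewrite card_sum.
  under eq_bigr => w _.
    rewrite (_ : nat_of_bool _ =
      (\sum_(k in D) \prod_e (phi (w.1 e) (w.2 e) == k e))%N); last first.
      pose k0 : {ffun E -> S} := [ffun e => phi (w.1 e) (w.2 e)].
      rewrite -/k0.
      have E0 (k : {ffun E -> S}) : (\prod_e (phi (w.1 e) (w.2 e) == k e))%N = (k0 == k).
        rewrite -(@big_morph _ _ nat_of_bool 1%N muln true andb) //; last by case; case.
        congr nat_of_bool; rewrite big_andE; apply/forallP/eqP => [h|<- e].
          by apply/ffunP => e; rewrite ffunE; apply/eqP/h.
        by rewrite ffunE eqxx.
      under eq_bigr do rewrite E0.
      rewrite big_mkcond /= (bigD1 k0) //= eqxx big1 ?addn0 => [|k].
        by case: (k0 \in D).
      by rewrite eq_sym; case: (k0 == k) => //; case: (k \in D).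
    over.
  rewrite exchange_big /=; apply: eq_bigr => k _.
  rewrite -(pair_bigA _ (fun (a : {ffun E -> S}) (b : {ffun E -> B}) =>
    (\prod_e (phi (a e) (b e) == k e))%N)) /=.
  rewrite /c bigA_distr_bigA /=; apply: eq_bigr => a _.
  by rewrite bigA_distr_bigA.
apply: (leq_trans (sqr_sum_le _ _)); rewrite leq_mul2l; apply/orP; right.
apply: (@leq_trans (\sum_(k : {ffun E -> S}) (\prod_e c (k e)) ^ 2)%N).
  by rewrite big_mkcond /=; apply: leq_sum => k _; case: ifP.
rewrite (eq_bigr (fun k : {ffun E -> S} => (\prod_e c (k e) ^ 2)%N)); last first.
  by move=> k _; apply: (big_morph (expn^~ 2)) => // x y; rewrite expnMn.
rewrite -(bigA_distr_bigA (fun _ : E => fun s => (c s ^ 2)%N)) /=.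
by rewrite prod_nat_const.
Qed.

(** The expected number of coordinates that satisfy [P], by linearity; it feeds
    Markov's inequality. *)
Lemma sum_card_hits (E S : finType) (P : pred S) :
  ((\sum_(k : {ffun E -> S}) #|[set e | P (k e)]|) * #|S| =
   #|E| * #|[set s | P s]| * #|S| ^ #|E|)%N.
Proof.
under eq_bigr do rewrite card_sum.
rewrite exchange_big /= big_distrl /=.
under eq_bigr => e _.
  rewrite (_ : (_ * _)%N = (#|[set s | P s]| * #|S| ^ #|E|)%N); first over.
  rewrite (eq_bigr (fun k : {ffun E -> S} =>
    (\prod_e' (if e' == e then nat_of_bool (P (k e')) else 1))%N)); last first.
    by move=> k _; rewrite -big_mkcond /= big_pred1_eq.
  rewrite -(bigA_distr_bigA (fun e' s => if e' == e then nat_of_bool (P s) else 1%N)).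
  rewrite (bigD1 e) //= eqxx -card_sum.
  rewrite (eq_bigr (fun _ => #|S|)); last first.
    by move=> e' /negbTE ->; rewrite sum1_card.
  rewrite prod_nat_const -mulnA -expnSr.
  have E0 : (0 < #|E|)%N by apply/card_gt0P; exists e.
  by rewrite (cardC1 e) prednK.
by rewrite sum_nat_const mulnA.
Qed.

(** A Chernoff bound for the lower tail of the number of [e] in [D] with
    [b0 (b e)], a binomial variable with parameters [#|D|] and [1 / #|B|]: the
    weight 1/2 per hit turns the exponential moment into a product over the
    coordinates, and [expR (-1) <= 1/2]. *)
Lemma card_few_hits_le (R : realType) (E B : finType) (D : {set E}) (b0 : pred B)
    (w : R) : (0 < #|B|)%N -> #|[set b | b0 b]| = 1%N ->
  #|[set b : {ffun E -> B} | (#|[set e in D | b0 (b e)]|%:R <= w)]|%:R <=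
  #|B|%:R ^+ #|E| * expR (w - #|D|%:R / (2 * #|B|%:R)).
Proof.
move=> B0 hb.
have B0' : 0 < #|B|%:R :> R by rewrite ltr0n.
apply: (@le_trans _ _ (\sum_(b : {ffun E -> B})
   expR w * \prod_e (if (e \in D) && b0 (b e) then 2^-1 else 1))).
  rewrite card_sum natr_sum; apply: ler_sum => b _.
  have P0 : 0 <= \prod_e (if (e \in D) && b0 (b e) then 2^-1 else 1) :> R.
    by apply: prodr_ge0 => e _; case: ifP.
  case: (boolP (_ <= w)) => [hw|_]; last by rewrite mulr_ge0 ?expR_ge0.
  rewrite -big_mkcond /= prodr_const.
  set q := #|_|.
  have -> : q = #|[set e in D | b0 (b e)]|.
    by rewrite /q; apply: eq_card => e; rewrite !inE.
  apply: (@le_trans _ _ (expR w * expR (- 1) ^+ #|[set e in D | b0 (b e)]|)).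
    rewrite -expRM_natl -expRD -[1%:R]expR0 ler_expR; lra.
  rewrite ler_wpM2l ?expR_ge0 // lerXn2r ?nnegrE ?expR_ge0 ?invr_ge0 //.
  rewrite expRN lef_pV2 ?posrE ?expR_gt0 //.
  by have := @expR_ge1Dx R 1; lra.
rewrite -mulr_sumr expRD mulrCA ler_wpM2l ?expR_ge0 //.
rewrite -(bigA_distr_bigA (fun e s => if (e \in D) && b0 s then 2^-1 else 1)) /=.
have sumB e : \sum_s (if (e \in D) && b0 s then 2^-1 else 1 : R) =
    #|B|%:R * (if e \in D then 1 - (2 * #|B|%:R)^-1 else 1).
  case: (e \in D) => /=; last by rewrite big_const iter_addr_0 mulr1.
  rewrite (eq_bigr (fun s => 1 - 2^-1 * (b0 s)%:R)); last first.
    by move=> s _; case: (b0 s) => /=; lra.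
  rewrite sumrB -mulr_sumr -natr_sum -card_sum hb sumr_const -/(#|B|%:R).
  rewrite mulrBr invfM mulrCA mulfV ?gt_eqF // !mulr1.
  by congr (_ %:R - _); exact: eq_card.
under eq_bigr do rewrite sumB.
rewrite big_split /= prodr_const ler_wpM2l ?exprn_ge0 ?ler0n //.
rewrite -big_mkcond /= prodr_const.
have -> : - (#|D|%:R / (2 * #|B|%:R)) = #|D|%:R * (- (2 * #|B|%:R)^-1) :> R by ring.
rewrite expRM_natl lerXn2r ?nnegrE ?expR_ge0 //.
  rewrite subr_ge0 invf_le1; last by rewrite mulr_gt0.
  have : 1 <= #|B|%:R :> R by rewrite ler1n.
  lra.
exact: expR_ge1Dx.
Qed.

(** * The randomised lowering of the indices *)

(** The move of one cell index.  Every index goes down by one, which puts the new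
    cell entirely below the old one; a marked index goes down by [t] more if it
    can.  The index 0 cannot move at all, but a configuration that contains it
    is unlikely. *)
Definition lower (t k : nat) (b : bool) : nat :=
  if b && (t < k)%N then (k - t.+1)%N else k.-1.

Lemma lower_lt_size (N t : nat) (k : 'I_N) (b : bool) : (lower t k b < N)%N.
Proof. by rewrite /lower; have := ltn_ord k; case: ifP => _; lia. Qed.

Lemma lower_ltn (t k : nat) (b : bool) : (0 < k)%N -> (lower t k b < k)%N.
Proof. by rewrite /lower; case: ifP => _; lia. Qed.

Lemma subn_lower (t k : nat) (b : bool) : (0 < k)%N ->
  (k - (lower t k b).+1 = (b && (t < k)) * t)%N.
Proof. by rewrite /lower; case: (b && _) / andP => [[_ tk]|_]; lia. Qed.

(** The mark is the event that an auxiliary uniform element of ['I_r] is 0, so a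
    uniform point of ['I_N * 'I_r] encodes the randomised move. *)
Definition lower_ord (N t r : nat) (k : 'I_N) (y : 'I_r) : 'I_N :=
  Ordinal (lower_lt_size t k (y == 0 :> nat)).

Lemma sum_eq_ord (M c : nat) : (\sum_(i < M) (i == c :> nat) = (c < M))%N.
Proof. by elim: M => [|M ih]; rewrite ?big_ord0 // big_ord_recr /= ih; lia. Qed.

Lemma sum_lt_ord (M t : nat) : (\sum_(i < M) (i < t) <= t)%N.
Proof.
suff -> : (\sum_(i < M) (i < t) = minn M t)%N by lia.
by elim: M => [|M ih]; rewrite ?big_ord0 ?min0n // big_ord_recr /= ih; lia.
Qed.

Lemma sum_ge_ord (N u : nat) : (\sum_(i < N) (N <= i + u) <= u)%N.
Proof.
suff h M : (\sum_(i < M) (N <= i + u) <= M + u - N)%N by have := h N; lia.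
elim: M => [|M ih]; rewrite ?big_ord0 // big_ord_recr /=.
by apply: (leq_trans (leq_add ih (leqnn _))); case: leqP; lia.
Qed.

(** The move would be a bijection of the indices for each value of the mark, and
    every fibre would have [r] elements, were it not for the two ends of
    ['I_N]; the indicators record what happens there. *)
Lemma card_lower_fiber (N t r : nat) (s : 'I_N) : (0 < r)%N ->
  (\sum_(x < N) \sum_(y < r) (lower_ord t x y == s) =
   r.-1 * ((s.+1 < N) + (s == 0 :> nat)) +
   ((s + t.+1 < N) + ((s < t) && (s.+1 < N)) + (s == 0 :> nat)))%N.
Proof.
case: r => // r _; rewrite exchange_big /= big_ord_recl addnC; congr addn.
  rewrite (eq_bigr (fun=> (s.+1 < N) + (s == 0 :> nat))%N) ?sum_nat_const ?card_ord //.
  move=> y _; rewrite (eq_bigr (fun x : 'I_N =>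
    (x == s.+1 :> nat) + (s == 0 :> nat) * (x == 0 :> nat))%N).
    rewrite big_split /= -big_distrr /= !sum_eq_ord.
    by have := ltn_ord s; case: (s == 0 :> nat) => /=; lia.
  move=> x _; rewrite -val_eqE /= /lower /=; lia.
rewrite (eq_bigr (fun x : 'I_N => (x == s + t.+1 :> nat) +
    (s < t) * (x == s.+1 :> nat) + (s == 0 :> nat) * (x == 0 :> nat))%N).
  rewrite !big_split /= -!big_distrr /= !sum_eq_ord.
  have := ltn_ord s; lia.
move=> x _; rewrite -val_eqE /= /lower /=; case: ltnP => h; lia.
Qed.

(** The second moment of the fibre sizes [c s].  Their mean is exactly [r], so
    the first-order terms cancel and only the sum of the [(c s - r) ^ 2] has to
    be controlled: the deviation is of size [r] at the two extreme indices and
    of size 1 on two blocks of about [t] indices. *)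
Lemma sum_sqr_lower_fiber (N t r : nat) : (0 < r)%N ->
  (\sum_(s < N) (\sum_(x < N) \sum_(y < r) (lower_ord t x y == s)) ^ 2 <=
   N * r ^ 2 + 4 * r ^ 2 + 4 * t.+1)%N.
Proof.
move=> r0; pose c (s : 'I_N) := (\sum_(x < N) \sum_(y < r) (lower_ord t x y == s))%N.
have sumc : (\sum_s c s = N * r)%N.
  rewrite /c exchange_big /= (eq_bigr (fun=> r)) ?sum_nat_const ?card_ord //.
  move=> x _; rewrite exchange_big /= (eq_bigr (fun=> 1%N)) ?sum_nat_const ?card_ord
    ?muln1 //.
  move=> y _; rewrite (eq_bigr (fun s : 'I_N => (s == lower_ord t x y :> nat) : nat)).
    by rewrite sum_eq_ord ltn_ord.
  by move=> s _; rewrite -val_eqE eq_sym.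
(* This is [(c s - r) ^ 2] expanded, bounded by twice the sum of the squares of
   the two kinds of deviation. *)
have pt s : (c s ^ 2 + r ^ 2 <= 2 * r * c s +
    2 * r ^ 2 * ((s == 0 :> nat) + (N <= s + 1)) +
    2 * ((s < t) + (N <= s + t.+1)))%N.
  rewrite /c card_lower_fiber //; case: r r0 {c sumc} => // r _ /=.
  have := ltn_ord s.
  case: (eqVneq (s : nat) 0) => h0; case: (leqP N (s + 1)) => h1; case: (ltnP s t) => h2;
  case: (leqP N (s + t.+1)) => h3 hs; rewrite ?h0 ?h1 ?h2 ?h3 /=; nia.
have : (\sum_s (c s ^ 2 + r ^ 2) <= \sum_(s < N) (2 * r * c s +
    2 * r ^ 2 * ((s == 0 :> nat) + (N <= s + 1)) +
    2 * ((s < t) + (N <= s + t.+1))))%N by apply: leq_sum => s _; exact: pt.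
rewrite !big_split /= -!big_distrr /= sum_nat_const card_ord sumc !big_split /=.
have := sum_lt_ord N t; have := sum_ge_ord N t.+1; have := sum_ge_ord N 1.
rewrite sum_eq_ord; have : ((0 < N) <= 1)%N by case: (0 < N)%N.
set a := (_ < _)%N; set b := (\sum_(i < N) (N <= i + 1))%N.
set d := (\sum_(i < N) (N <= i + t.+1))%N; set e := (\sum_(i < N) (i < t))%N.
rewrite big1_eq => a1 b1 d1 e1.
have : (r ^ 2 * (a + b) <= r ^ 2 * 2)%N by rewrite leq_mul2l; lia.
rewrite -/(\sum_(s < N) c s ^ 2)%N; set q := (\sum_(s < N) c s ^ 2)%N.
nia.
Qed.

(** * Existence of a compatible lowered configuration *)

Lemma card_fst (S T : finType) (P : pred S) :
  #|[set w : S * T | P w.1]| = (#|[set x | P x]| * #|T|)%N.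
Proof.
by rewrite -cardsT -cardsX; apply: eq_card => -[x y]; rewrite !inE andbT.
Qed.

(** This is [(1 + 0.12 / m) ^ m <= expR 0.12 <= 2]. *)
Lemma expn_add12_le (R : realType) (m : nat) : (0 < m)%N ->
  (((100 * m + 12) ^ m)%:R <= 2 * ((100 * m) ^ m)%:R :> R).
Proof.
move=> m0; have m0' : 0 < m%:R :> R by rewrite ltr0n.
rewrite !natrX natrD natrM.
have -> : 100%:R * m%:R + 12%:R = (1 + (3 / 25) / m%:R) * (100%:R * m%:R) :> R.
  by field; rewrite gt_eqF.
rewrite exprMn ler_wpM2r ?exprn_ge0 ?mulr_ge0 ?ler0n //.
apply: (@le_trans _ _ (expR (3 / 25))).
  rewrite [leRHS](_ : _ = expR ((3 / 25) / m%:R) ^+ m).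
    by rewrite lerXn2r ?nnegrE ?expR_ge0 ?expR_ge1Dx // addr_ge0 // divr_ge0 //; lra.
  by rewrite -expRM_natl; congr expR; field; rewrite gt_eqF.
have := @expR_ge1Dx R (- (3 / 25)); rewrite expRN => h.
have e0 : 0 < expR (3 / 25) :> R by exact: expR_gt0.
have : (1 + - (3 / 25)) * expR (3 / 25) <= 1 :> R.
  by rewrite -ler_pdivlMr // div1r.
lra.
Qed.

(** An event of probability at most 1/8 for a uniform configuration has
    probability at most 1/2 for the lowered one.  With [100 n^2] indices, marks
    of probability [1/r] of order [n^(-1/2)] and jumps of length [n], the
    second moment of the density is [1 + O(1/n^2)] per coordinate; there are
    [n^2] coordinates, so the total stays bounded, here by 2. *)
Lemma card_push_notin_le (R : realType) (E : finType) (n r : nat)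
    (D : {set {ffun E -> 'I_(100 * n ^ 2)}}) :
  #|E| = (n ^ 2)%N -> (0 < n)%N -> (n <= r ^ 2)%N ->
  (8 * #|D| <= (100 * n ^ 2) ^ (n ^ 2))%N ->
  (2 * #|[set w : {ffun E -> 'I_(100 * n ^ 2)} * {ffun E -> 'I_r} |
       [ffun e => lower_ord n (w.1 e) (w.2 e)] \in D]| <=
   (100 * n ^ 2) ^ (n ^ 2) * r ^ (n ^ 2))%N.
Proof.
move=> cE n0 nr hD.
have r0 : (0 < r)%N by case: r nr => // ; rewrite exp0n //; lia.
have := sqr_card_push_le (@lower_ord (100 * n ^ 2) n r) D.
set b := #|[set w | _]|; rewrite cE; set q := (\sum_(s < _) _)%N => hb.
have m0 : (0 < n ^ 2)%N by rewrite expn_gt0 n0.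
(* Here [n <= r ^ 2] absorbs the jumps: [4 r^2 + 4 (n + 1) <= 12 r^2]. *)
have hq : (q ^ (n ^ 2) <= (r ^ 2 * (100 * n ^ 2 + 12)) ^ (n ^ 2))%N.
  rewrite leq_exp2r //; apply: (leq_trans (sum_sqr_lower_fiber _ _ r0)).
  rewrite mulnDr mulnC -addnA leq_add2l.
  by move: nr; case: (r ^ 2)%N (expn_gt0 r 2) => [|k]; rewrite ?r0 //; lia.
have h12 : ((100 * n ^ 2 + 12) ^ (n ^ 2) <= 2 * (100 * n ^ 2) ^ (n ^ 2))%N.
  by rewrite -(ler_nat R) natrM; exact: expn_add12_le.
rewrite expnMn -expnM (mulnC 2%N) expnM in hq.
rewrite -(@leq_exp2r _ _ 2) // expnMn.
move: hD hb hq h12.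
move: ((100 * n ^ 2) ^ (n ^ 2))%N (q ^ (n ^ 2))%N ((100 * n ^ 2 + 12) ^ (n ^ 2))%N.
move: (r ^ (n ^ 2))%N #|D| => L d M Q Z hD hb hq h12.
apply: (@leq_trans (2 ^ 2 * (d * Q))%N); first by rewrite leq_mul2l hb orbT.
apply: (@leq_trans (2 ^ 2 * (d * (L ^ 2 * (2 * M))))%N).
  rewrite !leq_mul2l; apply/orP; right; apply/orP; right.
  by apply: (leq_trans hq); rewrite leq_mul2l h12 orbT.
rewrite (_ : 2 ^ 2 * _ = (8 * d) * (L ^ 2 * M))%N; last by ring.
by rewrite (_ : (M * L) ^ 2 = M * (L ^ 2 * M))%N ?leq_mul2r ?hD ?orbT //; ring.
Qed.

Lemma card_has_zero_le (E : finType) (n : nat) : #|E| = (n ^ 2)%N -> (0 < n)%N ->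
  (100 * #|[set k : {ffun E -> 'I_(100 * n ^ 2)} | [exists e, k e == 0 :> nat]]| <=
   (100 * n ^ 2) ^ (n ^ 2))%N.
Proof.
move=> cE n0; have m0 : (0 < n ^ 2)%N by rewrite expn_gt0 n0.
have := @sum_card_hits E _ (fun k : 'I_(100 * n ^ 2) => k == 0 :> nat).
rewrite cE card_ord [#|[set s | _]|]card_sum sum_eq_ord muln_gt0 m0 /= muln1.
set s := (\sum_k _)%N => hs.
have {}hs : (100 * s = (100 * n ^ 2) ^ (n ^ 2))%N.
  by apply/eqP; rewrite -(eqn_pmul2l m0) -hs; apply/eqP; ring.
have : (#|[set k : {ffun E -> 'I_(100 * n ^ 2)} | [exists e, k e == 0 :> nat]]| <= s)%N.
  rewrite card_sum; apply: leq_sum => k _.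
  case: (boolP [exists e, _]) => // /existsP[e he].
  by apply/card_gt0P; exists e; rewrite inE.
by rewrite -hs leq_mul2l => ->; rewrite orbT.
Qed.

Lemma card_many_small_le (E : finType) (n : nat) : #|E| = (n ^ 2)%N -> (0 < n)%N ->
  (25 * #|[set k : {ffun E -> 'I_(100 * n ^ 2)} |
     (n <= 2 * #|[set e | (k e <= n)%N]|)%N]| <= (100 * n ^ 2) ^ (n ^ 2))%N.
Proof.
move=> cE n0; have m0 : (0 < n ^ 2)%N by rewrite expn_gt0 n0.
have := @sum_card_hits E _ (fun k : 'I_(100 * n ^ 2) => (k <= n)%N).
rewrite cE card_ord [#|[set s | _]|]card_sum.
have hn := sum_lt_ord (100 * n ^ 2) n.+1.
set s := (\sum_(k : {ffun _ -> _}) _)%N => hs.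
have : (n * #|[set k : {ffun E -> 'I_(100 * n ^ 2)} |
     (n <= 2 * #|[set e | (k e <= n)%N]|)%N]| <= 2 * s)%N.
  rewrite card_sum /s !big_distrr /=; apply: leq_sum => k _.
  by case: (boolP (n <= 2 * _)%N) => h; rewrite ?muln0 ?muln1 ?h.
have {hs hn}: (100 * s <= n.+1 * (100 * n ^ 2) ^ (n ^ 2))%N.
  rewrite -(leq_pmul2l m0) (_ : n ^ 2 * (100 * s) = s * (100 * n ^ 2))%N; last by ring.
  by rewrite hs -mulnA leq_mul2l leq_mul2r hn !orbT.
move: ((100 * n ^ 2) ^ (n ^ 2))%N => M; nia.
Qed.

(** The set [sel k] of [n] coordinates depends on [k] but not on the marks.
    If fewer than [n/2] indices are at most [n], then at least [n/2] coordinates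
    of [sel k] fall by [n] as soon as they are marked.  The expected number of
    marked ones is at least [n/(2r) >= r/8], so that at most [r/32] of them is
    a large deviation. *)
Lemma card_few_moved_le (R : realType) (E : finType) (n r : nat)
    (sel : {ffun E -> 'I_(100 * n ^ 2)} -> {set E}) :
  #|E| = (n ^ 2)%N -> (320 <= r)%N -> (r ^ 2 <= 4 * n)%N ->
  (forall k, #|sel k| = n) ->
  (10 * #|[set w : {ffun E -> 'I_(100 * n ^ 2)} * {ffun E -> 'I_r} |
     (2 * #|[set e | (w.1 e <= n)%N]| < n)%N &&
     (32 * #|[set e in sel w.1 | (w.2 e == 0 :> nat) && (n < w.1 e)%N]| <= r)%N]| <=
   (100 * n ^ 2) ^ (n ^ 2) * r ^ (n ^ 2))%N.
Proof.
move=> cE r320 rn hsel; rewrite card_sum.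
have r0 : 0 < r%:R :> R by rewrite ltr0n; lia.
rewrite -(pair_bigA _ (fun (k : {ffun E -> 'I_(100 * n ^ 2)}) (b : {ffun E -> 'I_r}) =>
  ((2 * #|[set e | (k e <= n)%N]| < n)%N &&
     (32 * #|[set e in sel k | (b e == 0 :> nat) && (n < k e)%N]| <= r)%N) : nat)) /=.
rewrite big_distrr /=.
have -> : ((100 * n ^ 2) ^ (n ^ 2) * r ^ (n ^ 2) =
    \sum_(k : {ffun E -> 'I_(100 * n ^ 2)}) r ^ (n ^ 2))%N.
  by rewrite sum_nat_const card_ffun card_ord cE.
apply: leq_sum => k _.
case: ltnP => hk /=; last by rewrite big1 ?muln0.
pose D := [set e in sel k | (n < k e)%N].
have hD : (r ^ 2 <= 8 * #|D|)%N.
  have : (n <= #|D| + #|[set e | (k e <= n)%N]|)%N.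
    rewrite -[X in (X <= _)%N](hsel k).
    apply: (@leq_trans #|D :|: [set e | (k e <= n)%N]|); last first.
      exact: (leq_card_setU _ _).1.
    apply: subset_leq_card.
    by apply/fintype.subsetP => e he; rewrite !inE he /=; case: leqP.
  lia.
rewrite -card_sum -(ler_nat R) natrM.
have := @card_few_hits_le R E 'I_r D (fun y => y == 0 :> nat) (r%:R / 32).
rewrite card_ord; have -> : #|[set b : 'I_r | b == 0 :> nat]| = 1%N.
  by rewrite card_sum sum_eq_ord; lia.
move=> /(_ ltac:(lia) erefl) h.
rewrite (_ : [set b : {ffun E -> 'I_r} | _] = [set b : {ffun E -> 'I_r} |
    (#|[set e in D | b e == 0 :> nat]|%:R <= r%:R / 32 :> R)]); last first.
  apply/setP => b; rewrite !inE ler_pdivlMr // -natrM ler_nat mulnC.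
  congr (_ * _ <= _)%N; apply: eq_card => e; rewrite !inE.
  by rewrite -andbA; congr andb; rewrite andbC.
apply: (le_trans (ler_wpM2l _ h)) => //.
rewrite cE natrX mulrCA ler_piMr ?exprn_ge0 ?ler0n //.
have r320' : 320 <= r%:R :> R by rewrite ler_nat.
have hD' : r%:R * r%:R <= 8 * #|D|%:R :> R by rewrite -!natrM ler_nat mulnn.
(* The constant 320 makes the exponent at most -10, and [expR (-10) <= 1/10]. *)
have hle : r%:R / 32 - #|D|%:R / (2 * r%:R) <= - 10 :> R.
  have : r%:R / 16 <= #|D|%:R / (2 * r%:R) :> R.
    by rewrite ler_pdivlMr ?mulr_gt0 //; nra.
  lra.
apply: (@le_trans _ _ (10 * expR (- 10))); first by rewrite ler_wpM2l // ler_expR.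
rewrite expRN ler_pdivrMr ?expR_gt0 //.
by have := @expR_ge1Dx R 10; lra.
Qed.

(** The five exceptional events have probabilities at most 1/8, 1/2, 1/100,
    1/25 and 1/10, whose sum is less than 1: some configuration avoids them
    all. *)
Lemma exists_lowered_pair (R : realType) (E : finType) (n r : nat)
    (A : {set {ffun E -> 'I_(100 * n ^ 2)}})
    (sel : {ffun E -> 'I_(100 * n ^ 2)} -> {set E}) :
  #|E| = (n ^ 2)%N -> (0 < n)%N -> (320 <= r)%N ->
  (n <= r ^ 2)%N -> (r ^ 2 <= 4 * n)%N -> (forall k, #|sel k| = n) ->
  (8 * #|~: A| <= (100 * n ^ 2) ^ (n ^ 2))%N ->
  exists (k : {ffun E -> 'I_(100 * n ^ 2)}) (b : {ffun E -> 'I_r}),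
    [/\ k \in A, [ffun e => lower_ord n (k e) (b e)] \in A,
        forall e, (0 < k e)%N &
        (r < 32 * #|[set e in sel k | (b e == 0 :> nat) && (n < k e)%N]|)%N].
Proof.
move=> cE n0 r320 nr rn hsel hA.
pose W := ({ffun E -> 'I_(100 * n ^ 2)} * {ffun E -> 'I_r})%type.
pose B1 := [set w : W | w.1 \in ~: A].
pose B2 := [set w : W | [ffun e => lower_ord n (w.1 e) (w.2 e)] \in ~: A].
pose B3 := [set w : W | [exists e, w.1 e == 0 :> nat]].
pose B4 := [set w : W | (n <= 2 * #|[set e | (w.1 e <= n)%N]|)%N].
pose B5 := [set w : W | (2 * #|[set e | (w.1 e <= n)%N]| < n)%N &&
  (32 * #|[set e in sel w.1 | (w.2 e == 0 :> nat) && (n < w.1 e)%N]| <= r)%N].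
have cW : #|{: W}| = ((100 * n ^ 2) ^ (n ^ 2) * r ^ (n ^ 2))%N.
  by rewrite card_prod !card_ffun !card_ord cE.
have h1 : (8 * #|B1| <= #|{: W}|)%N.
  rewrite /B1 card_fst cW card_ffun card_ord cE mulnA leq_mul2r.
  by rewrite (_ : [set x | x \in ~: A] = ~: A) ?hA ?orbT //; apply/setP => k; rewrite inE.
have h2 : (2 * #|B2| <= #|{: W}|)%N by rewrite cW; exact: card_push_notin_le.
have h3 : (100 * #|B3| <= #|{: W}|)%N.
  rewrite /B3 (card_fst _ (fun k : {ffun E -> 'I_(100 * n ^ 2)} =>
    [exists e, k e == 0 :> nat])).
  by rewrite cW card_ffun card_ord cE mulnA leq_mul2r card_has_zero_le ?orbT.
have h4 : (25 * #|B4| <= #|{: W}|)%N.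
  rewrite /B4 (card_fst _ (fun k : {ffun E -> 'I_(100 * n ^ 2)} =>
    n <= 2 * #|[set e | (k e <= n)%N]|)%N).
  by rewrite cW card_ffun card_ord cE mulnA leq_mul2r card_many_small_le ?orbT.
have h5 : (10 * #|B5| <= #|{: W}|)%N by rewrite cW; exact: card_few_moved_le.
have W0 : (0 < #|{: W}|)%N by rewrite cW muln_gt0 !expn_gt0; lia.
have : (#|B1 :|: B2 :|: B3 :|: B4 :|: B5| < #|{: W}|)%N.
  have := (leq_card_setU (B1 :|: B2 :|: B3 :|: B4) B5).1.
  have := (leq_card_setU (B1 :|: B2 :|: B3) B4).1.
  have := (leq_card_setU (B1 :|: B2) B3).1; have := (leq_card_setU B1 B2).1.
  lia.
set U := (_ :|: B5) => hlt.
have [[k b]|all_in] := pickP [pred w | w \notin U]; last first.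
  have : (#|{: W}| <= #|U|)%N.
    by apply/subset_leq_card/fintype.subsetP => w _; have /negbFE := all_in w.
  by rewrite leqNgt hlt.
rewrite !inE /= !negb_or !negbK -!andbA => /and5P[kA bA k0 h4' h5'].
exists k, b; split => //.
  move=> e; rewrite lt0n; apply: contraTN k0 => k0.
  by apply/existsP; exists e.
by move: h4' h5'; rewrite -ltnNge => -> /=; rewrite -ltnNge.
Qed.

Local Open Scope classical_set_scope.
Local Open Scope ring_scope.

(** * Bounded densities and quantiles *)

(** Near 0 the density is close to [expR (- V 0)], near infinity it tends to 0,
    and in between it is continuous on a compact interval. *)
Lemma class_Pplus1_bounded (R : realType) (f : R -> R) : class_Pplus1 f ->
  exists2 M : R, 0 < M & forall x, 0 <= f x <= M.
Proof.
case=> V [[fE _] dV _ [V0 _] Voo].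
have ge0 x : 0 <= f x by rewrite fE; case: ifP => // _; exact: expR_ge0.
have := Voo 1%:P; under eq_fun do rewrite hornerC.
move=> /cvgrPdist_lt /(_ 1 ltr01) [N [Nr hN]].
move: V0 => /cvgrPdist_lt /(_ 1 ltr01) [/= e e0 he].
have [c _ hc] : exists2 c, c \in `[e / 2, Num.max (e / 2) (N + 1)] &
    forall t, t \in `[e / 2, Num.max (e / 2) (N + 1)] -> V c <= V t.
  apply: EVT_min; first by rewrite le_max lexx.
  apply: derivable_within_continuous => x; rewrite in_itv /= => /andP[xe _].
  by apply: (dV 0%N); lra.
pose M := expR (- V 0) + expR (1 - V 0) + expR (- V c) + 1.
have p1 : 0 < expR (- V 0) by exact: expR_gt0.
have p2 : 0 < expR (1 - V 0) by exact: expR_gt0.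
have p3 : 0 < expR (- V c) by exact: expR_gt0.
exists M => [|x]; first by rewrite /M; lra.
rewrite ge0 /= fE; case: ifPn => [|_]; last by rewrite /M; lra.
rewrite le_eqVlt => /predU1P[<-|x0]; first by rewrite /M; lra.
have [xe|xe] := ltP x (e / 2).
  have := he x; rewrite /ball_ /= sub0r normrN gtr0_norm // => /(_ ltac:(lra) x0) h.
  have : expR (- V x) <= expR (1 - V 0).
    by rewrite ler_expR; have := ler_norm (V 0 - V x); lra.
  by rewrite /M; lra.
have [xN|xN] := leP x (N + 1).
  have : expR (- V x) <= expR (- V c).
    by rewrite ler_expR lerN2 hc // in_itv /= xe le_max xN orbT.
  by rewrite /M; lra.
have := hN x ltac:(lra); rewrite /= sub0r normrN div1r -expRN gtr0_norm ?expR_gt0 // => h.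
by rewrite /M; lra.
Qed.

(** Both sides are suprema of integrals of the simple functions below the
    integrand, and more simple functions lie below the constant [M]. *)
Lemma integral_bounded_le (R : realType) (f : R -> R) (M : R) (A : set R) :
  0 <= M -> (forall x, 0 <= f x <= M) -> measurable A ->
  (\int[lebesgue_measure]_(x in A) (f x)%:E <= M%:E * lebesgue_measure A)%E.
Proof.
move=> M0 hf mA; rewrite -integral_cst //.
rewrite !ge0_integralE; last 2 first.
- by move=> x _; rewrite lee_fin; case/andP: (hf x).
- by move=> x _; rewrite lee_fin.
apply: le_ereal_sup => _ [h /= hh <-]; exists h => //= x.
apply: (le_trans (hh x)); rewrite !patchE; case: ifP => // _.
by rewrite lee_fin; have /andP[] := hf x.
Qed.

Lemma cdf_increment_le (R : realType) d (T : measurableType d)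
    (P : probability T R) (X : {RV P >-> R}) (M x y : R) : 0 <= M ->
  (forall A, measurable A ->
     (distribution P X A <= M%:E * lebesgue_measure A)%E) ->
  x <= y -> (cdf X y - cdf X x <= (M * (y - x))%:E)%E.
Proof.
move=> M0 hM xy; rewrite /cdf.
have -> : (distribution P X `]-oo, y] - distribution P X `]-oo, x] =
    distribution P X `]x, y])%E.
  have -> : [set` `]x, y]] = `]-oo, y] `\` `]-oo, x].
    apply/seteqP; split=> z /=; rewrite !in_itv /=; last first.
      by move=> [-> /negP]; rewrite -ltNge => ->.
    by move=> /andP[? ->]; split=> //; apply/negP; rewrite -ltNge.
  rewrite measureD //=; last by rewrite ltey_eq fin_num_measure.
  rewrite (_ : `]-oo, y] `&` `]-oo, x] = [set` `]-oo, x]]) //.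
  apply/seteqP; split=> z /=; rewrite !in_itv /=; first by case.
  by move=> zx; rewrite zx (le_trans zx).
apply: (le_trans (hM _ _)) => //; rewrite lebesgue_measure_itv /= lte_fin.
case: ifP => [_|_]; first by rewrite -EFinB -EFinM.
by rewrite mule0 lee_fin mulr_ge0 ?subr_ge0.
Qed.

(** The distribution function is Lipschitz with constant [M], hence takes every
    value between its limits 0 and 1. *)
Lemma exists_quantile (R : realType) d (T : measurableType d)
    (P : probability T R) (X : {RV P >-> R}) (M v : R) : 0 < M ->
  (forall A, measurable A ->
     (distribution P X A <= M%:E * lebesgue_measure A)%E) ->
  0 < v < 1 -> exists q : R, cdf X q = v%:E.
Proof.
move=> M0 hM /andP[v0 v1]; pose F x := fine (cdf X x).
have FE x : cdf X x = (F x)%:E by rewrite /F fineK // fin_num_measure.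
have Fmono x y : x <= y -> F x <= F y.
  by move=> xy; rewrite -lee_fin -!FE; exact: cdf_nondecreasing.
have Flip x y : x <= y -> F y - F x <= M * (y - x).
  by move=> xy; rewrite -lee_fin EFinB -!FE; apply: cdf_increment_le => //; exact: ltW.
have [a ha] : exists a, F a <= v.
  have /fine_cvg/cvgrPdist_lt/(_ _ v0)[N [_ hN]] := cvg_cdfNy0 X.
  exists (N - 1); have := hN (N - 1) ltac:(lra); rewrite /= -/(F _) sub0r normrN.
  by have := ler_norm (F (N - 1)); lra.
have [b hb] : exists b, v <= F b.
  have v1' : 0 < 1 - v by lra.
  have /fine_cvg/cvgrPdist_lt/(_ _ v1')[N [_ hN]] := cvg_cdfy1 X.
  exists (N + 1); have := hN (N + 1) ltac:(lra); rewrite /= -/(F _).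
  by have := ler_norm (1 - F (N + 1)); lra.
have [|||q _ hq] := @IVT R F (Num.min a b) (Num.max a b) v.
- by rewrite ge_min le_max lexx.
- apply: continuous_subspaceT => x; apply/cvgrPdist_lt => e e0.
  exists (e / M) => /=; first by rewrite divr_gt0.
  move=> y /=; rewrite ltr_pdivlMr // => h.
  apply: le_lt_trans h; have [xy|/ltW yx] := leP x y.
    rewrite distrC ger0_norm ?subr_ge0 ?Fmono // distrC ger0_norm ?subr_ge0 //.
    by rewrite mulrC Flip.
  by rewrite !ger0_norm ?subr_ge0 ?Fmono // mulrC Flip.
- have h' : F (Num.min a b) <= v.
    by apply: le_trans ha; rewrite Fmono // ge_min lexx.
  have h : v <= F (Num.max a b).
    by apply: (le_trans hb); rewrite Fmono // le_max lexx orbT.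
  by rewrite ge_min h' le_max h orbT.
by exists q; rewrite FE hq.
Qed.

(** [G k] is the half-line below the quantile of order [k / N], with the empty
    set and the whole line at the two ends.  The last property says that
    quantiles are far apart, because an interval of length [h] has probability
    at most [M * h]; the two degenerate sets satisfy it vacuously, so that the
    unbounded extreme cells need no separate treatment. *)
Lemma exists_quantile_chain (R : realType) d (T : measurableType d)
    (P : probability T R) (X : {RV P >-> R}) (M : R) (N : nat) :
  0 < M -> (0 < N)%N ->
  (forall A, measurable A ->
     (distribution P X A <= M%:E * lebesgue_measure A)%E) ->
  exists G : nat -> set R,
    [/\ forall k, measurable (G k), G 0%N = set0, G N = setT,
        forall k, (k <= N)%N -> distribution P X (G k) = (k%:R / N%:R)%:E &
        forall j k x y, (j <= k)%N -> G j y -> ~ G k x ->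
          (k - j)%:R / (N%:R * M) <= x - y].
Proof.
move=> M0 N0 hM; have N0' : 0 < N%:R :> R by rewrite ltr0n.
have /choice[q hq] : forall k : nat, exists q : R,
    (0 < k < N)%N -> cdf X q = (k%:R / N%:R)%:E.
  move=> k; have [/andP[k0 kN]|_] := boolP (0 < k < N)%N; last by exists 0.
  have [|q hq] := @exists_quantile _ _ _ _ X M (k%:R / N%:R) M0 hM; last by exists q.
  by rewrite divr_gt0 ?ltr0n //= ltr_pdivrMr // mul1r ltr_nat.
pose G k := if (k == 0)%N then set0 else if (k < N)%N then [set` `]-oo, q k]] else setT.
exists G; split => [k|||k|j k x y].
- by rewrite /G; case: ifP => // _; case: ifP.
- by rewrite /G eqxx.
- by rewrite /G gtn_eqF // ltnn.
- rewrite leq_eqVlt => /predU1P[->|kN]; rewrite /G.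
    by rewrite gtn_eqF // ltnn probability_setT divff // gt_eqF.
  case: eqVneq => [->|k0]; first by rewrite measure0 mul0r.
  by rewrite kN -[LHS]/(cdf X (q k)) hq // kN lt0n k0.
rewrite /G => jk; case: eqVneq => // j0.
have -> : (k == 0)%N = false by apply/negbTE; rewrite -lt0n (leq_trans _ jk) // lt0n.
case: (ltnP k N) => [kN|_]; last by move=> _ /(_ I).
have jN := leq_ltn_trans jk kN.
rewrite jN /= !in_itv /= => yj /negP; rewrite -ltNge => xk.
move: jk; rewrite leq_eqVlt => /predU1P[jk|jk].
  by rewrite -jk subnn mul0r; move: xk; rewrite -jk; lra.
have hj := hq j ltac:(lia); have hk := hq k ltac:(lia).
have qjk : q j <= q k.
  rewrite leNgt; apply/negP => /ltW/(cdf_nondecreasing X).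
  by rewrite hj hk lee_fin ler_pM2r ?invr_gt0 // ler_nat leqNgt jk.
have hq' := cdf_increment_le (ltW M0) hM qjk.
rewrite hj hk -EFinB lee_fin in hq'.
apply: (@le_trans _ _ (q k - q j)); last by lra.
rewrite ler_pdivrMr ?mulr_gt0 // natrB; last exact: ltnW.
rewrite [X in _ <= X](_ : _ = M * (q k - q j) * N%:R); last by ring.
by rewrite -ler_pdivrMr // mulrBl.
Qed.

Lemma measure_bigsetU_le (R : realType) d (T : measurableType d)
    (P : {measure set T -> \bar R}) (I : finType) (A : {pred I})
    (F : I -> set T) : (forall i, measurable (F i)) ->
  (P (\big[setU/set0]_(i in A) F i) <= \sum_(i in A) P (F i))%E.
Proof.
move=> mF; rewrite -!big_enum /=; elim: (enum A) => [|i s ih].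
  by rewrite !big_nil measure0.
rewrite !big_cons; apply: (le_trans (measureU2 _ _ _)) => //.
  by apply: bigsetU_measurable => j _.
by rewrite leeD2l.
Qed.

(** * The assignment problem *)

(** The optimal cost as a function of the cost matrix alone. *)
Definition assignment_cost (R : realType) (n : nat) (x : 'I_n * 'I_n -> R) : R :=
  \big[Num.min/(\sum_(i < n) x (i, i))]_(s : 'S_n) (\sum_(i < n) x (i, s i)).

Lemma assignment_cost_attained (R : realType) (n : nat) (x : 'I_n * 'I_n -> R) :
  exists s : 'S_n, assignment_cost x = \sum_(i < n) x (i, s i).
Proof.
rewrite /assignment_cost; elim/big_ind : _ => [|u v [s ->] [s' ->]|s _].
- by exists 1%g; apply: eq_bigr => i _; rewrite perm1.
- by rewrite /Order.min; case: ifP => _; [exists s|exists s'].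
- by exists s.
Qed.

Definition graph_of (n : nat) (s : 'S_n) : {set 'I_n * 'I_n} :=
  [set (i, s i) | i : 'I_n].

Lemma card_graph_of (n : nat) (s : 'S_n) : #|graph_of s| = n.
Proof. by rewrite card_imset ?card_ord // => i j []. Qed.

Lemma sum_graph_of (R : realType) (n : nat) (s : 'S_n) (x : 'I_n * 'I_n -> R) :
  \sum_(i < n) x (i, s i) = \sum_(e in graph_of s) x e.
Proof. by rewrite big_imset //= => i j _ _ []. Qed.

(** The core of the theorem, for a fixed [n].  Call a configuration of cell
    indices compatible when some cost matrix with entries in these cells has
    its optimal cost in the interval.  If at least 7/8 of the configurations
    were compatible, there would be two compatible ones as in
    [exists_lowered_pair], where [sel] is the graph of an optimal permutation
    of a compatible matrix [x].  For a compatible matrix [y] of the lowered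
    configuration, the cost of this permutation is smaller by more than the
    length of the interval, which is absurd.  So fewer than 7/8 of them are
    compatible, and all configurations are equally likely. *)
Lemma optimal_cost_interval_le (R : realType) d (T : measurableType d)
    (P : probability T R) (n r : nat) (a : 'I_n -> 'I_n -> {RV P >-> R})
    (M alpha beta : R) :
  (0 < n)%N -> (320 <= r)%N -> (n <= r ^ 2)%N -> (r ^ 2 <= 4 * n)%N -> 0 < M ->
  mutually_independent P (fun e : 'I_n * 'I_n => a e.1 e.2) ->
  (forall i j i' j' A, measurable A ->
     distribution P (a i j) A = distribution P (a i' j') A) ->
  (forall i j A, measurable A ->
     (distribution P (a i j) A <= M%:E * lebesgue_measure A)%E) ->
  beta - alpha <= r%:R / 32 / (100 * n%:R * M) ->
  (P [set w | (alpha <= optimal_cost P a w <= beta)%R] <= (1 - 8^-1)%:E)%E.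
Proof.
move=> n0 r320 nr rn M0 indep same hM hab.
pose X (e : 'I_n * 'I_n) := a e.1 e.2.
have n0' : 0 < n%:R :> R by rewrite ltr0n.
have D0 : 0 < 100 * n%:R * M by rewrite !mulr_gt0.
pose N := (100 * n ^ 2)%N; have N0 : (0 < N)%N by rewrite muln_gt0 expn_gt0 n0.
have N0' : 0 < N%:R :> R by rewrite ltr0n.
have cE : #|{: 'I_n * 'I_n}| = (n ^ 2)%N by rewrite card_prod card_ord mulnn.
have [G [mG G0 GN PG gap]] := exists_quantile_chain M0 N0 (hM (Ordinal n0) (Ordinal n0)).
pose cell k := G k.+1 `\` G k.
have mcell k : measurable (cell k) by exact: measurableD.
have subG k : G k `<=` G k.+1.
  move=> y yk; apply: contrapT => /(gap _ _ _ _ (leqnSn k) yk).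
  rewrite subrr subSnn leNgt => /negP; apply.
  by rewrite divr_gt0 // mulr_gt0.
have Pcell e k : (k < N)%N -> distribution P (X e) (cell k) = (N%:R^-1)%:E.
  move=> kN; rewrite (same _ _ (Ordinal n0) (Ordinal n0)) // measureD //=; last first.
    by rewrite ltey_eq fin_num_measure.
  rewrite setIidr // !PG //; last exact: ltnW.
  by rewrite -EFinB -mulrBl -natrB // subSnn div1r.
(* The least [k] with [x] in [G k] is the upper end of the cell of [x]. *)
have cover x : exists k : 'I_N, cell k x.
  have : exists k, `[< G k x >] by exists N; apply/asboolP; rewrite GN.
  case/ex_minnP => -[|k /asboolP kx kmin]; first by move/asboolP; rewrite G0.
  have kN : (k < N)%N by apply: kmin; apply/asboolP; rewrite GN.
  exists (Ordinal kN); split => //= kx'.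
  by have := kmin k (asboolT kx'); rewrite ltnn.
pose compatible (k : {ffun 'I_n * 'I_n -> 'I_N}) (x : 'I_n * 'I_n -> R) :=
  (forall e, cell (k e) (x e)) /\ alpha <= assignment_cost x <= beta.
pose A := [set k : {ffun 'I_n * 'I_n -> 'I_N} | `[< exists x, compatible k x >]]%SET.
have inA k : k \in A -> exists x, compatible k x by rewrite inE => /asboolP.
have hcard : (N ^ (n ^ 2) < 8 * #|~: A|)%N.
  rewrite ltnNge; apply/negP => hA.
  (* The permutation is chosen as a function of [k] alone, before any mark. *)
  have /choice[g hg] : forall k : {ffun 'I_n * 'I_n -> 'I_N},
      exists xs : ('I_n * 'I_n -> R) * 'S_n, k \in A ->
        compatible k xs.1 /\ assignment_cost xs.1 = \sum_(i < n) xs.1 (i, xs.2 i).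
    move=> k; have [/inA[x hx]|_] := boolP (k \in A); last by exists (fun=> 0, 1%g).
    by have [s hs] := assignment_cost_attained x; exists (x, s).
  have [k [b [kA kA' kpos moved]]] := @exists_lowered_pair R _ n r A
    (fun k => graph_of (g k).2) cE n0 r320 nr rn (fun k => card_graph_of _) hA.
  have [[xcell /andP[_ xbeta]] xopt] := hg k kA.
  have [y [ycell /andP[yalpha _]]] := inA _ kA'.
  move: (g k) moved xcell xbeta xopt => [x s] /= moved xcell xbeta xopt.
  pose good := [set e | (b e == 0 :> nat) && (n < k e)%N]%SET.
  pose delta : R := n%:R / (N%:R * M).
  (* Entries that are only lowered by one contribute nothing, by comparison of
     adjacent cells. *)
  have drop e : y e <= x e - (e \in good)%:R * delta.
    have [_ hx] := xcell e; have [hy _] := ycell e.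
    rewrite ffunE in hy; have := gap _ _ _ _ (lower_ltn _ _ (kpos e)) hy hx.
    by rewrite subn_lower // natrM -mulrA -/delta inE; lra.
  have hy : alpha <= beta - #|[set e in graph_of s |
      (b e == 0 :> nat) && (n < k e)%N]%SET|%:R * delta.
    apply: (le_trans yalpha).
    apply: (@le_trans _ _ (\sum_(i < n) y (i, s i))); first exact: bigmin_le.
    rewrite (le_trans _ (lerB xbeta (lexx _))) // xopt !sum_graph_of.
    apply: (le_trans (ler_sum _ (fun e _ => drop e))).
    rewrite sumrB lerD2l lerN2 -mulr_suml ler_wpM2r //.
      by rewrite divr_ge0 // mulr_ge0 // ltW.
    rewrite -natr_sum ler_nat card_sum [leqRHS]big_mkcond /=; apply: leq_sum => e _.
    by rewrite inE; case: (e \in graph_of s).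
  move: hy moved; set W := #|_| => hy; rewrite -(ltr_nat R) natrM => moved.
  have deltaE : delta = 1 / (100 * n%:R * M).
    rewrite /delta /N natrM natrX; field.
    by rewrite !gt_eqF.
  have hr : r%:R / 32 / (100 * n%:R * M) < W%:R * delta.
    rewrite deltaE mul1r ltr_pM2r ?invr_gt0 // ltr_pdivrMr //.
    by rewrite mulrC.
  lra.
pose F (k : {ffun 'I_n * 'I_n -> 'I_N}) :=
  \bigcap_(e in [set` [set: 'I_n * 'I_n]%SET]) X e @^-1` cell (k e).
have mF k : measurable (F k).
  apply: fin_bigcap_measurable => [|e _]; first exact: finite_finset.
  by rewrite -[X in measurable X]setTI; exact: measurable_funP.
have PF k : P (F k) = (N%:R^-1 ^+ (n ^ 2))%:E.
  rewrite indep; last by move=> e; exact: mcell.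
  rewrite (eq_bigr (fun=> (N%:R^-1)%:E)); last first.
    by move=> e _; exact: (Pcell e _ (ltn_ord (k e))).
  by rewrite prodEFin prodr_const cardsT cE.
have sub : [set w | alpha <= optimal_cost P a w <= beta] `<=`
    \big[setU/set0]_(k in A) F k.
  move=> w hw; have /choice[k hk] := fun e => cover (X e w).
  rewrite -bigcup_pred; exists [ffun e => k e].
    rewrite /= inE; apply/asboolP; exists (fun e => X e w); split => // e.
    by rewrite ffunE.
  by move=> e _; rewrite /= ffunE.
apply: (le_trans (le_measure _ _ _ sub)); rewrite ?inE.
- rewrite -[X in measurable X]setTI.
  have := measurable_optimal_cost a measurableT (measurable_itv `[alpha, beta]).
  by congr measurable; apply/seteqP; split=> w /=; rewrite in_itv.
- by apply: bigsetU_measurable.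
apply: (le_trans (measure_bigsetU_le _ _ mF)).
rewrite (eq_bigr (fun=> (N%:R^-1 ^+ (n ^ 2))%:E)); last by move=> k _; exact: PF.
rewrite sumEFin sumr_const lee_fin.
have hA : (8 * #|A| <= 7 * N ^ (n ^ 2))%N.
  have := cardsC A; rewrite card_ffun card_ord cE; lia.
have Nm : 0 < N%:R ^+ (n ^ 2) :> R by rewrite exprn_gt0.
rewrite -[leLHS]mulr_natl exprVn ler_pdivrMr //.
have : 8 * #|A|%:R <= 7 * N%:R ^+ (n ^ 2) :> R by rewrite -natrX -!natrM ler_nat.
lra.
Qed.

Lemma exists_near_sqrt (n : nat) : (0 < n)%N ->
  exists2 r : nat, (n <= r ^ 2)%N & (r ^ 2 <= 4 * n)%N.
Proof.
move=> n0; have : exists r, (n <= r ^ 2)%N by exists n; nia.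
case/ex_minnP => r nr rmin; exists r => //.
case: r nr rmin => [|[|r]] nr rmin; [by nia|by nia|].
have : ~~ (n <= r.+1 ^ 2)%N by apply/negP => /rmin; rewrite ltnn.
nia.
Qed.

Lemma powRN_half_le (R : realType) (n r : nat) : (0 < n)%N -> (n <= r ^ 2)%N ->
  n%:R `^ (- 2^-1) <= r%:R / n%:R :> R.
Proof.
move=> n0 nr; have n0' : 0 < n%:R :> R by rewrite ltr0n.
have s0 : 0 < Num.sqrt n%:R :> R by rewrite sqrtr_gt0.
rewrite powRN powR12_sqrt ?ler0n // ler_pdivlMr // ler_pdivrMl //.
rewrite -[leLHS]sqr_sqrtr ?ler0n // expr2 ler_pM2l //.
rewrite -(ger0_norm (ler0n _ r)) -sqrtr_sqr ler_sqrt ?exprn_ge0 ?ler0n //.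
by rewrite -natrX ler_nat.
Qed.

Theorem theorem2p9 (R : realType)
    (f : R -> R) (hf : class_Pplus1 f)
    (d : nat -> measure_display) (T : forall n, measurableType (d n))
    (P : forall n, probability (T n) R)
    (a : forall n, 'I_n -> 'I_n -> {RV (P n) >-> R})
    (ha_ge0 : forall n (i j : 'I_n), {ae P n, forall w, 0 <= a n i j w})
    (ha_indep : forall n,
       mutually_independent (P n) (fun ij : 'I_n * 'I_n => a n ij.1 ij.2))
    (ha_law : forall n (i j : 'I_n),
       has_density (distribution (P n) (a n i j)) f) :
  fluctuations_at_least P (fun n => optimal_cost (P n) (a n))
    (fun n => n%:R `^ (- 2^-1)).
Proof.
have [M M0 fM] := class_Pplus1_bounded hf.
(* With [r >= sqrt n], the length [r / (32 * 100 n M)] allowed for a given [n] is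
   at least this constant times [n^(-1/2)]. *)
exists (1 / 32 / (100 * M)), 8^-1; split.
- by rewrite divr_gt0 // mulr_gt0.
- by [].
near=> n => alpha beta _ hab.
have nbig : (320 ^ 2 <= n)%N by near: n; exact: nbhs_infty_ge.
have n0 : (0 < n)%N by apply: leq_trans nbig; rewrite expn_gt0.
have [r nr rn] := exists_near_sqrt n0.
have r320 : (320 <= r)%N by rewrite -(@leq_exp2r _ _ 2) // (leq_trans nbig).
apply: (@optimal_cost_interval_le _ _ _ _ n r _ M) => //.
- by move=> i j i' j' A mA; rewrite !ha_law.
- by move=> i j A mA; rewrite ha_law //; apply: integral_bounded_le => //; exact: ltW.
apply: (le_trans hab).
have n0' : 0 < n%:R :> R by rewrite ltr0n.
apply: (le_trans (ler_wpM2l _ (powRN_half_le R n0 nr))).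
  by rewrite divr_ge0 // mulr_ge0 // ltW.
rewrite le_eqVlt; apply/orP; left; apply/eqP; field.
by rewrite !gt_eqF.
Unshelve. all: by end_near. Qed.
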